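(* Let $\mathbb F_q$ be a finite field of characteristic $p$ with $q=p^s$ elements, let $n\ge2$, let $b\in\mathbb F_q^*$ and let $k,k_1,\dots,k_n,m_1,\dots,m_n$ be positive integers. Let $N_q$ be the number of solutions $(x_1,\dots,x_n)\in\mathbb F_q^n$ of $$(x_1^{m_1}+\dots+x_n^{m_n})^k=bx_1^{k_1}\cdots x_n^{k_n}.$$ Let $d_j=\gcd(m_j,q-1)$, $D=\mathrm{lcm}[d_1,\dots,d_n]$, $M=\mathrm{lcm}[m_1,\dots,m_n]$ and $k_0=\gcd(k,k_1,\dots,k_n,q-1)$. Assume that $b$ is a $k_0$th power in $\mathbb F_q$, that $D>2$, that there exists a positive integer $\ell$ with $D\mid p^\ell+1$ (let $\ell$ be the minimal such integer), and that $$\gcd\Bigl(\sum_{j=1}^n\frac{k_jM}{k_0m_j}-\frac{kM}{k_0},\ \frac{k_1(q-1)}{k_0d_1},\dots,\frac{k_n(q-1)}{k_0d_n},\ \frac{q-1}{k_0}\Bigr)=1.$$ Then $2\ell\mid s$ and $$N_q=q^{n-1}-(-1)^n+\frac{(k_0-1)((q-1)^n-(-1)^n)}{q}-(-1)^{((s/2\ell)-1)n}k_0q^{(n-2)/2}I(d_1,\dots,d_n)-(-1)^n(k_0+q-1)\sum_{r=2}^{n-1}(-1)^{rs/2\ell}q^{(r-2)/2}\sum_{1\le j_1<\dots<j_r\le n}I(d_{j_1},\dots,d_{j_r}).$$ In particular, if $d_1=\dots=d_n=D$, then $$N_q=q^{n-1}-(-1)^n+\frac{(k_0-1)((q-1)^n-(-1)^n)}{q}-(-1)^{((s/2\ell)-1)n}k_0q^{(n-2)/2}\frac{(D-1)^n+(-1)^n(D-1)}{D}-(-1)^n(k_0+q-1)\sum_{r=2}^{n-1}(-1)^{rs/2\ell}q^{(r-2)/2}\binom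 nr\frac{(D-1)^r+(-1)^r(D-1)}{D}.$$
   Context: For positive integers $v_1,\dots,v_r$, $I(v_1,\dots,v_r)$ denotes the number of $r$-tuples $(j_1,\dots,j_r)$ of integers with $1\le j_i\le v_i-1$ for all $i$ such that $j_1/v_1+\dots+j_r/v_r$ is an integer. *)

(* Defs.v *)
From HB Require Import structures.
From mathcomp Require Import all_boot all_order all_algebra.
Set Implicit Arguments. Unset Strict Implicit. Unset Printing Implicit Defensive.
Import Order.TTheory GRing.Theory Num.Theory.
Local Open Scope ring_scope.

(* I over an index set A of a finite type T with moduli v : T -> nat:
   the number of families (j_i)_{i in A} with 1 <= j_i <= v_i - 1 and
   \sum_{i in A} j_i / v_i an integer.  Families are encoded as finite
   functions on T that vanish outside A (a bijective encoding). *)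
Definition Ion (T : finType) (v : T -> nat) (A : {set T}) : nat :=
  #|[set j : {ffun T -> 'I_(\max_(i : T) v i)} |
      [forall i, if i \in A then ((0 < j i) && (j i < v i))%N else val (j i) == 0%N]
      && ((\sum_(i in A) ((val (j i))%:R / (v i)%:R : rat)) \is a Num.int)]|.

Definition Ifull (n : nat) (v : 'I_n -> nat) : nat := Ion v setT.

Definition Nsol (F : finFieldType) (n : nat) (b : F) (k : nat)
    (kk m : 'I_n -> nat) : nat :=
  #|[set x : {ffun 'I_n -> F} |
      (\sum_i x i ^+ m i) ^+ k == b * \prod_i x i ^+ kk i]|.

(* Main.v *)
Require Import Defs.
From HB Require Import structures.
From mathcomp Require Import all_boot all_order all_algebra.
From mathcomp Require Import all_fingroup all_solvable all_field all_character.
From mathcomp Require Import ring zify.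
Set Implicit Arguments. Unset Strict Implicit. Unset Printing Implicit Defensive.
Import Order.TTheory GRing.Theory Num.Theory.
Local Open Scope ring_scope.

(** Write q = #|F|, N = q - 1, Q = p^l, T(x) = \sum_i x_i^(m_i), and let N0
    (resp. N') be the number of zeros of T (resp. of those without zero entry).

    The solutions with T(x) <> 0 have no zero entry.  On the x with
    nonzero entries the torus { h | h_i^(m_i) = mu for all i } multiplies T by
    mu, and the ratio of the two sides of the equation by
    prod_i h_i^(k_i) / mu^k; the gcd hypothesis says that these ratios are
    exactly the k0-th powers.  Hence the k0-th powers b all give the same number
    of such solutions, and N * N_q = k0 * (N^n - N') + N * (N0 - N').

    The counts N0 and N' are computed with the sums S_m(y) = \sum_x psi(y x^m)
    for an additive character psi invariant under Frobenius.  For m = Q + 1 the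
    form x^(Q+1) is Hermitian, so S(y)^2 is q times the size of the radical
    { z | y z + y^Q z^(Q^2) = 0 }, which is 1 or Q^2; the sign follows from
    S(y) = 1 mod Q + 1.  Averaging S_(Q+1)(y w^m) over w gives S_m for every m
    with gcd(m, N) dividing Q + 1: for a suitable u,
    S_m(u g^e) = (-Q)^t (1 - d [d | e]) where d = gcd(m, N) and q = Q^(2t).
    Expanding the brackets in roots of unity produces the numbers I(d_i, ...). *)

(** * Roots of unity and additive characters of a finite field *)

Lemma finField_prim_root (F : finFieldType) :
  exists g : F, #|F|.-1.-primitive_root g.
Proof.
have F_gt1 := finNzRing_gt1 F.
have N_gt0 : (0 < #|F|.-1)%N by rewrite -subn1 subn_gt0.
pose rs := enum [pred x : F | x != 0].
have := @has_prim_root F #|F|.-1 rs N_gt0.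
case/(_ _ _ _)/hasP => [|||g _ gP]; last by exists g.
- apply/allP => x; rewrite mem_enum inE => x0; apply/unity_rootP.
  by apply: (mulfI x0); rewrite -exprS prednK ?expf_card ?mulr1 // ltnW.
- exact: enum_uniq.
- rewrite -cardE -ltnS prednK; last exact: ltnW.
  by rewrite (cardD1 0) inE ltnS; apply/subset_leq_card/subsetP=> x; rewrite !inE andbT.
Qed.

(** The character is a linear character of the additive group composed with the absolute trace [Tr],
    which is additive and Frobenius-invariant. The last clause records that it factors through the
    trace. *)
Lemma frob_additive_character (F : finFieldType) (p s : nat) :
  p \in [pchar F] -> #|F| = (p ^ s)%N ->
  exists psi : F -> algC, [/\ {morph psi : x y / x + y >-> x * y},
    forall x, psi (x ^+ p) = psi x, exists x, psi x != 1,
    forall x, psi x \in Aint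
    & forall x, \sum_(i < s) x ^+ (p ^ i) = 0 -> psi x = 1].
Proof.
move=> pF cF; have p_pr := pcharf_prime pF.
have p_gt0 := prime_gt0 p_pr; have p_gt1 := prime_gt1 p_pr.
have s_gt0 : (0 < s)%N.
  by case: s cF => // cF; have := finNzRing_gt1 F; rewrite cF.
pose Tr (x : F) := \sum_(i < s) x ^+ (p ^ i).
have TrD : {morph Tr : x y / x + y}.
  move=> x y; rewrite /Tr -big_split; apply: eq_bigr => i _.
  by rewrite exprDn_pchar // (eq_pnat _ (pcharf_eq pF)) pnatX pnat_id.
have Trp x : Tr (x ^+ p) = Tr x.
  rewrite /Tr; case: s s_gt0 cF {Tr TrD} => // s _ cF.
  rewrite big_ord_recr big_ord_recl /= expn0 expr1 addrC -exprM.
  rewrite -expnS -cF expf_card; congr (_ + _).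
  by apply: eq_bigr => i _; rewrite /bump add1n expnS exprM.
have [x0 Trx0] : exists x0, Tr x0 != 0.
  (* The trace is a polynomial of degree p^(s-1), too small to vanish at all p^s elements. *)
  pose P : {poly F} := \sum_(i < s) 'X^(p ^ i).
  have sP : size P = (p ^ s.-1).+1.
    case: s s_gt0 @P {Tr TrD Trp cF} => // s _; rewrite big_ord_recr /=.
    rewrite addrC size_polyDl ?size_polyXn // ltnS.
    apply: (leq_trans (size_sum _ _ _)); apply/bigmax_leqP => i _.
    by rewrite size_polyXn ltn_exp2l.
  have P0 : P != 0 by rewrite -size_poly_eq0 sP.
  case: (pickP (fun x => Tr x != 0)) => [x|all0]; first by exists x.
  have := @max_poly_roots _ P (enum F) P0; rewrite enum_uniq => /(_ _ isT).
  rewrite -cardE cF sP ltnS leq_exp2l // leqNgt prednK // leqnn.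
  move=> roots_enum; suff: false by []; apply: roots_enum; apply/allP => x _.
  move/negbFE/eqP: (all0 x) => Trx; apply/rootP; rewrite -Trx horner_sum.
  by apply: eq_bigr => i _; rewrite hornerXn.
have abF : abelian [set: F] by apply/centsP => x _ y _; exact: addrC.
(* Irreducible characters have trivial common kernel, so one of them does not kill [Tr x0]. *)
have /existsP[i chi_i] : [exists i, Tr x0 \notin cfker 'chi[[set: F]]_i].
  apply: contraR Trx0; rewrite negb_exists => /forallP kerP.
  have : Tr x0 \in \bigcap_i cfker 'chi[[set: F]]_i.
    by apply/bigcapP => i _; have := kerP i; rewrite negbK.
  by rewrite TI_cfker_irr inE.
have lin_i : 'chi[[set: F]]_i \is a linear_char by apply/char_abelianP.
exists (fun x => 'chi[[set: F]]_i (Tr x)); split.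
- move=> x y; rewrite TrD; exact: (lin_charM lin_i (in_setT _) (in_setT _)).
- by move=> x; rewrite Trp.
- exists x0; apply: contra chi_i => /eqP chi1.
  by rewrite cfkerEirr inE chi1 (lin_char1 lin_i).
- by move=> x; apply/Aint_char/irr_char.
- move=> x; rewrite -/(Tr x) => ->.
  exact: (lin_char1 lin_i).
Qed.

Lemma sum_prim_root_expr (R : idomainType) (N : nat) (w : R) (a : nat) :
  N.-primitive_root w ->
  \sum_(e < N) w ^+ (e * a) = if (N %| a)%N then N%:R else 0.
Proof.
move=> wP; case: ifP => Na.
  rewrite -[N in RHS]card_ord -sumr_const; apply: eq_bigr => e _.
  by apply/eqP; rewrite -(prim_order_dvd wP) dvdn_mull.
have wa1 : w ^+ a - 1 != 0 by rewrite subr_eq0 -(prim_order_dvd wP) Na.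
apply: (mulfI wa1); rewrite mulr0.
under eq_bigr => e _ do rewrite mulnC exprM.
by rewrite -subrX1 exprAC (prim_expr_order wP) expr1n subrr.
Qed.

Lemma sum_additive_character (F : finFieldType) (psi : F -> algC) (c : F) :
  {morph psi : x y / x + y >-> x * y} -> (exists x, psi x != 1) -> psi 0 = 1 ->
  \sum_x psi (x * c) = if c == 0 then #|F|%:R else 0.
Proof.
move=> psiD [x0 psix0] psi0; case: ifP => [/eqP-> | /negbT c0].
  by under eq_bigr do rewrite mulr0 psi0; rewrite sumr_const.
rewrite -subr_eq0 in psix0; apply: (mulfI psix0); rewrite mulr0 mulrBl mul1r.
rewrite mulr_sumr [X in _ - X](reindex_inj (addrI (x0 / c))) /=.
apply/eqP; rewrite subr_eq0; apply/eqP; apply: eq_bigr => x _.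
by rewrite mulrDl psiD divfK.
Qed.

(** The a-th roots of unity are the powers of g^(N/a), and b divides N/a. *)
Lemma unity_root_extraction (F : fieldType) (N a b : nat) (g c : F) :
  N.-primitive_root g -> (a * b %| N)%N -> c ^+ a = 1 ->
  exists j, (g ^+ j) ^+ b = c.
Proof.
move=> gP abN ca1; have aN : (a %| N)%N := dvdn_trans (dvdn_mulr _ (dvdnn a)) abN.
have N_gt0 := prim_order_gt0 gP.
have a_gt0 : (0 < a)%N := dvdn_gt0 N_gt0 aN.
have hP := dvdn_prim_root gP aN.
have [i ->] := prim_rootP hP ca1.
have [k Nk] := dvdnP abN.
exists (k * i)%N; rewrite -!exprM; congr (g ^+ _).
by rewrite Nk [(a * b)%N]mulnC mulnA mulnK // mulnAC.
Qed.

(** The fixed points are 0 and the K-th roots of unity. For K = Q^2 - 1 this counts the subfield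
    with Q^2 elements. *)
Lemma card_expr_fixed (F : finFieldType) (K : nat) :
  (K %| #|F|.-1)%N -> #|[set x : F | x ^+ K.+1 == x]| = K.+1.
Proof.
move=> KN; have [g gP] := finField_prim_root F.
have N_gt0 := prim_order_gt0 gP; have K_gt0 : (0 < K)%N := dvdn_gt0 N_gt0 KN.
have hP := dvdn_prim_root gP KN; set h := g ^+ _ in hP.
have h0 : h != 0 by rewrite (prim_root_eq0 hP) -lt0n.
have inj_h : injective (fun i : 'I_K => h ^+ i).
  move=> i j /eqP; rewrite (eq_prim_root_expr hP) !modn_small // => /eqP.
  exact: val_inj.
have -> : [set x : F | x ^+ K.+1 == x] = 0 |: [set h ^+ (i : 'I_K) | i in 'I_K].
  apply/setP=> x; rewrite !inE; have [-> | x0] /= := eqVneq x 0.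
    by rewrite expr0n /= !eqxx.
  apply/idP/imsetP => [/eqP xK | [i _ ->]].
    have /(prim_rootP hP)[i ->] : x ^+ K = 1; last by exists i.
    by apply: (mulfI x0); rewrite -exprS xK mulr1.
  by rewrite exprS -exprM mulnC exprM (prim_expr_order hP) expr1n mulr1.
rewrite cardsU1 card_imset // card_ord (_ : 0 \notin _) //.
by apply/imsetP => -[i _ /esym/eqP]; rewrite expf_eq0 (negPf h0) andbF.
Qed.

Lemma sum_antiperiodic (V : zmodType) (f : nat -> V) (l t : nat) :
  (forall i, f (l + i)%N = - f i) -> \sum_(i < 2 * l * t) f i = 0.
Proof.
move=> fN; elim: t => [|t IHt]; first by rewrite muln0 big_ord0.
rewrite mulnS mul2n -addnn -addnA big_split_ord /=.
rewrite [X in _ + X]big_split_ord /= addrA.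
under [X in _ + X + _]eq_bigr do rewrite fN.
rewrite sumrN subrr add0r -[RHS]IHt mul2n -addnn.
by apply: eq_bigr => i _; rewrite !fN opprK.
Qed.

(** * Semiprimitive power sums *)

Definition power_sum (F : finFieldType) (psi : F -> algC) (m : nat) (y : F) :=
  \sum_x psi (y * x ^+ m).

(* On the radical, u := y z^(Q+1) satisfies u^Q = - u, so psi u = 1 because the
   trace of u cancels in blocks of length 2l. *)
Lemma hermitian_sum_sqr (F : finFieldType) (p l t : nat) (psi : F -> algC) (y : F) :
  p \in [pchar F] -> #|F| = (p ^ (2 * l * t))%N -> (0 < t)%N ->
  ((p ^ l).-1 * (p ^ l).+1 %| #|F|.-1)%N ->
  {morph psi : x y / x + y >-> x * y} -> (forall x, psi (x ^+ p) = psi x) ->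
  (exists x, psi x != 1) ->
  (forall x, \sum_(i < 2 * l * t) x ^+ (p ^ i) = 0 -> psi x = 1) ->
  let Q := (p ^ l)%N in
  power_sum psi Q.+1 y ^+ 2
    = #|F|%:R * #|[set z | y * z + y ^+ Q * z ^+ (Q ^ 2) == 0]|%:R.
Proof.
move=> pF cF t_gt0 QN psiD psip psi_nt psi_tr Q.
have p_pr := pcharf_prime pF; have p_gt0 := prime_gt0 p_pr.
have Q_gt0 : (0 < Q)%N by rewrite expn_gt0 p_gt0.
have psi0 : psi 0 = 1.
  apply: psi_tr; rewrite big1 // => i _.
  by rewrite expr0n; case: eqP => // /eqP; rewrite expn_eq0 -leqn0 leqNgt p_gt0.
have psiQ x : psi (x ^+ Q) = psi x.
  by rewrite /Q; elim: (l) => [|l' IH]; rewrite ?expr1 // expnSr exprM psip.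
have QD x z : (x + z) ^+ Q = x ^+ Q + z ^+ Q :> F.
  by rewrite exprDn_pchar // (eq_pnat _ (pcharf_eq pF)) pnatX pnat_id.
have frob_inj : injective (fun x : F => x ^+ Q).
  apply: (can_inj (g := fun x => x ^+ (p ^ (2 * l * t - l)))) => x.
  rewrite -exprM /Q -expnD subnKC -?cF ?expf_card //.
  by case: (t) t_gt0 => // t2 _; rewrite mulnS mul2n -addnn -addnA leq_addr.
have [g gP] := finField_prim_root F.
have N1 : (-1 : F) ^+ Q.-1 = 1.
  have [p2 | p_odd] := even_prime p_pr.
    by rewrite oppr_pchar2 ?expr1n // -p2.
  have : odd Q by rewrite oddX p_odd orbT.
  by case: (Q) Q_gt0 => //= Q' _ oQ; rewrite -signr_odd (negPf oQ).
(* Here v^(Q+1) = -1, so x -> v x gives S(y) = S(-y), and the square can be treated as S(y)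
   S(-y). *)
have [j] := unity_root_extraction gP QN N1; set v := g ^+ j => vP.
have v0 : v != 0.
  by apply/eqP => v0; move/eqP: vP; rewrite v0 expr0n /= eq_sym oppr_eq0 oner_eq0.
have SN : power_sum psi Q.+1 y = \sum_z psi (- (y * z ^+ Q.+1)).
  rewrite /power_sum (reindex_inj (mulfI v0)); apply: eq_bigr => x _.
  by congr psi; rewrite exprMn vP mulN1r mulrN.
rewrite expr2 {2}SN /power_sum mulr_suml.
(* After x -> x + z the terms in z^(Q+1) cancel. Frobenius invariance replaces y z x^Q by y^Q z^Q
   x^(Q^2), so the argument is linear in z^Q, and orthogonality in z leaves only the x in the
   radical. *)
transitivity (\sum_x \sum_z psi (y * x ^+ Q.+1) *
   psi (z ^+ Q * (y * x + y ^+ Q * x ^+ (Q ^ 2)))).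
  rewrite exchange_big /=.
  under eq_bigr => i _ do rewrite mulr_sumr.
  rewrite exchange_big; apply: eq_bigr => z _.
  rewrite (reindex_inj (addIr z)) /=; apply: eq_bigr => x _.
  have -> : psi (z ^+ Q * (y * x + y ^+ Q * x ^+ (Q ^ 2)))
          = psi (z ^+ Q * (y * x) + z * y * x ^+ Q).
    by rewrite mulrDr !psiD -(psiQ (z * y * _)) !exprMn -exprM mulnn !mulrA.
  by rewrite -!psiD !exprS QD; congr psi; ring.
have sumQ c : \sum_z psi (z ^+ Q * c) = \sum_z psi (z * c).
  by rewrite [RHS](reindex_inj frob_inj).
under eq_bigr => x _ do rewrite -mulr_sumr sumQ sum_additive_character //.
rewrite (bigID (fun z => y * z + y ^+ Q * z ^+ (Q ^ 2) == 0)) /=.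
rewrite [X in _ + X]big1 => [|x /negPf->]; last by rewrite mulr0.
rewrite addr0 mulr_natr -[RHS]sumr_const; apply: eq_big => [x|x /[dup] W ->].
  by rewrite inE.
rewrite psi_tr ?mul1r //; set u := y * _.
have uQ : u ^+ Q = - u.
  rewrite /u exprMn -exprM mulSn mulnn exprD mulrCA.
  have /eqP -> : y ^+ Q * x ^+ (Q ^ 2) == - (y * x) by rewrite -addr_eq0 addrC.
  by rewrite exprSr; ring.
rewrite (sum_antiperiodic _ (f := fun i => u ^+ (p ^ i))) // => i.
rewrite expnD exprM -/Q uQ; have [p2 | p_odd] := even_prime p_pr.
  by rewrite !oppr_pchar2 // -p2.
by rewrite exprNn -signr_odd oddX p_odd orbT mulN1r.
Qed.

Lemma sum_periodic (V : zmodType) (f : nat -> V) (M a : nat) :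
  (forall i, f (M + i)%N = f i) -> \sum_(i < M * a) f i = (\sum_(i < M) f i) *+ a.
Proof.
move=> fM; elim: a => [|a IHa]; first by rewrite muln0 big_ord0.
rewrite mulnS big_split_ord /= mulrS -IHa; congr (_ + _).
by apply: eq_bigr => i _; rewrite fM.
Qed.

Lemma sum_multiples (V : zmodType) (f : nat -> V) (d r : nat) : (0 < r)%N ->
  \sum_(a < d * r | (r %| a)%N) f a = \sum_(a < d) f (a * r)%N.
Proof.
move=> r_gt0; elim: d => [|d IHd]; first by rewrite !big_ord0.
rewrite big_ord_recr -IHd mulSnr big_split_ord /=; congr (_ + _).
rewrite (bigD1 (Ordinal r_gt0)) ?addn0 ?dvdn_mull //= big1 ?addr0 // => i.
case/andP; rewrite dvdn_addr ?dvdn_mull // => ri i0.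
by case/eqP: i0; apply: val_inj => /=; move: ri; rewrite /dvdn modn_small // => /eqP.
Qed.

Lemma finField_prim_rootP (F : finFieldType) (g x : F) :
  #|F|.-1.-primitive_root g -> x != 0 -> {i : 'I_#|F|.-1 | x = g ^+ i}.
Proof.
move=> gP x0; apply: (prim_rootP gP); apply: (mulfI x0).
by rewrite -exprS prednK ?expf_card ?mulr1 // ltnW // finNzRing_gt1.
Qed.

Lemma big_finField_prim (F : finFieldType) (V : nmodType) (g : F) (f : F -> V) :
  #|F|.-1.-primitive_root g ->
  \sum_(x | x != 0) f x = \sum_(e < #|F|.-1) f (g ^+ e).
Proof.
move=> gP; have g0 : g != 0 by rewrite (prim_root_eq0 gP) -lt0n (prim_order_gt0 gP).
have inj_g : injective (fun i : 'I_#|F|.-1 => g ^+ i).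
  move=> i j /eqP; rewrite (eq_prim_root_expr gP) !modn_small // => /eqP.
  exact: val_inj.
rewrite -(big_imset _ (in2W inj_g)) /=; apply: eq_bigl => x.
apply/idP/imsetP => [/(finField_prim_rootP gP)[i ->]|[i _ ->]]; first by exists i.
exact: expf_neq0.
Qed.

(* S is an integer congruent to 1, and Q to -1, modulo Q + 1 > 2. *)
Lemma Aint_square_sign (S T : algC) (Q a : nat) : (1 < Q)%N ->
  S ^+ 2 = (Q ^ a)%:R ^+ 2 -> S = 1 + Q.+1%:R * T -> T \in Aint ->
  S = (- Q%:R) ^+ a.
Proof.
move=> Q_gt1 S2 ST AT.
have : S ^+ 2 == ((- Q%:R) ^+ a) ^+ 2.
  by rewrite S2 exprNn exprMn sqrr_sign mul1r natrX.
rewrite eqf_sqr => /orP[] /eqP // SE; exfalso.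
have Q1 : Q.+1%:R != 0 :> algC by rewrite pnatr_eq0.
(* Even with the wrong sign S is rational, so T is a rational algebraic integer, hence an
   integer. *)
have : T \in Crat.
  have -> : T = (S - 1) / Q.+1%:R by rewrite ST addrC addKr mulrC mulKf.
  by rewrite SE rpred_div ?rpredB ?rpredN ?rpredX ?rpred1 ?rpred_nat ?rpredN ?rpred_nat.
move/Cint_rat_Aint/(_ AT)/intrP => [z Tz].
have : (- (- Q%:Z) ^+ a = 1 + Q.+1%:Z * z).
  by apply: (@intr_inj algC); rewrite rmorphN rmorphXn rmorphD rmorphM rmorphN /= -Tz -SE.
have [y yP] : exists y, (- Q%:Z) ^+ a - 1 = Q.+1%:Z * y.
  rewrite subrX1; eexists (- \sum_(i < a) _); rewrite mulrN -mulNr; congr (_ * _).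
  by rewrite -opprD [Q%:Z + 1]addrC -intS.
(* Both (-Q)^a and its negative would be 1 modulo Q + 1. *)
move=> zP; have : (Q.+1%:Z %| 2)%Z.
  apply/dvdzP; exists (- (z + y)); rewrite mulNr mulrDl ![_ * Q.+1%:Z]mulrC -yP.
  by apply/eqP; rewrite -subr_eq0 -[Q.+1%:Z * z](addKr 1) -zP; apply/eqP; ring.
by rewrite /dvdz /= => /dvdn_leq; lia.
Qed.

(** The term x = 0 gives 1, and each nonzero k-th power is hit k times because g^(ik) has period N/k
    in i. This is the congruence that fixes the sign of the Hermitian sum. *)
Lemma Aint_power_sum_quotient (F : finFieldType) (psi : F -> algC) (k : nat) (y : F) :
  (k %| #|F|.-1)%N -> (forall x, psi x \in Aint) -> psi 0 = 1 -> (0 < k)%N ->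
  exists2 T, T \in Aint & power_sum psi k y = 1 + k%:R * T.
Proof.
move=> kN psiA psi0 k_gt0; have [g gP] := finField_prim_root F.
exists (\sum_(i < #|F|.-1 %/ k) psi (y * g ^+ (i * k))).
  by apply: rpred_sum => i _; apply: psiA.
rewrite /power_sum (bigD1 0) //= expr0n gtn_eqF // mulr0 psi0; congr (_ + _).
rewrite (big_finField_prim _ gP) mulr_natl.
rewrite -(sum_periodic _ (f := fun i => psi (y * g ^+ (i * k)))) => [|i].
  by rewrite divnK //; apply: eq_bigr => i _; rewrite -exprM.
by rewrite mulnDl divnK // exprD (prim_expr_order gP) mul1r.
Qed.

Section SemiprimitiveSums.

Variables (F : finFieldType) (p l t : nat) (psi : F -> algC) (g u : F).
Hypothesis charF : p \in [pchar F].
Hypothesis cardF : #|F| = (p ^ (2 * l * t))%N.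
Hypotheses (l_gt0 : (0 < l)%N) (t_gt0 : (0 < t)%N).
Hypothesis psiD : {morph psi : x y / x + y >-> x * y}.
Hypothesis psi_frob : forall x, psi (x ^+ p) = psi x.
Hypothesis psi_nontrivial : exists x, psi x != 1.
Hypothesis psi_Aint : forall x, psi x \in Aint.
Hypothesis psi_trace : forall x, \sum_(i < 2 * l * t) x ^+ (p ^ i) = 0 -> psi x = 1.
Hypothesis gP : #|F|.-1.-primitive_root g.
Let Q := (p ^ l)%N.
(* The radical at u y is nontrivial exactly when y is a (Q+1)-st power. *)
Hypothesis uP : u ^+ Q.-1 = -1.

Let N := #|F|.-1.
Let p_pr : prime p := pcharf_prime charF.

Lemma semiprimitive_gt1 : (1 < Q)%N.
Proof. by rewrite -(expn0 p) ltn_exp2l // prime_gt1. Qed.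

Lemma semiprimitive_card : #|F| = (Q ^ (2 * t))%N.
Proof. by rewrite cardF -expnM mulnCA mulnA. Qed.

Lemma semiprimitive_dvdn : (Q.-1 * Q.+1 %| N)%N.
Proof.
have Q_gt1 := semiprimitive_gt1.
rewrite /N semiprimitive_card expnM; apply: dvdn_trans (dvdn_pred_predX _ _).
by rewrite -addn1 -[Q.-1]subn1 -subn_sqr exp1n subn1.
Qed.

Let psi0 : psi 0 = 1.
Proof.
apply: psi_trace; rewrite big1 // => i _.
by rewrite expr0n gtn_eqF // expn_gt0 prime_gt0.
Qed.

Let g0 : g != 0.
Proof. by rewrite (prim_root_eq0 gP) -lt0n (prim_order_gt0 gP). Qed.

Let Q1_gt0 : (0 < Q.-1)%N.
Proof. by rewrite -subn1 subn_gt0 semiprimitive_gt1. Qed.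

Let u0 : u != 0.
Proof.
apply: contra_eqN uP => /eqP->.
by rewrite expr0n (gtn_eqF Q1_gt0) eq_sym oppr_eq0 oner_eq0.
Qed.

(** Since u^Q = -u, a nonzero z = g^f lies in the radical exactly when g^((Q-1)(e + f(Q+1))) = 1,
    which forces Q + 1 to divide e. Conversely, for e = f(Q+1) and h = g^f the equation says that z
    h is fixed by the power Q^2. *)
Lemma card_hermitian_radical e :
  #|[set z | u * g ^+ e * z + (u * g ^+ e) ^+ Q * z ^+ (Q ^ 2) == 0]|
    = (Q ^ (2 * (Q.+1 %| e)))%N.
Proof.
have Q_gt1 := semiprimitive_gt1; have Q_gt0 := ltnW Q_gt1.
have uQ : u ^+ Q = - u by rewrite -(prednK Q_gt0) exprS uP mulrN1.
have K2 : (Q ^ 2 = (Q.-1 * Q.+1).+1)%N.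
  rewrite -{2}[Q]prednK // -[X in (_ * X)%N]addn1 -[Q.-1]subn1 -subn_sqr exp1n.
  by rewrite subn1 prednK // expn_gt0 Q_gt0.
case: (boolP (Q.+1 %| e)%N) => [/dvdnP[f ->] | Qe].
  rewrite exprM muln1; set h := g ^+ f.
  have h0 : h != 0 by rewrite expf_neq0.
  rewrite [RHS]K2 -(card_expr_fixed semiprimitive_dvdn) -[RHS](card_preimset _ (mulIf h0)) -K2.
  apply: eq_card => z; rewrite !inE.
  have -> : u * h ^+ Q.+1 * z + (u * h ^+ Q.+1) ^+ Q * z ^+ (Q ^ 2)
          = u * h ^+ Q * (z * h - (z * h) ^+ (Q ^ 2)).
    by rewrite !exprMn uQ -[h ^+ _ ^+ _]exprM mulSn mulnn exprD exprSr; ring.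
  by rewrite mulf_eq0 mulf_eq0 (negPf u0) expf_eq0 (negPf h0) andbF subr_eq0 eq_sym.
rewrite muln0 expn0 -[RHS](cards1 (0 : F)); apply: eq_card => z; rewrite !inE.
have [-> | z0] := eqVneq z 0.
  by rewrite mulr0 expr0n gtn_eqF ?mulr0 ?addr0 ?eqxx // expn_gt0 Q_gt0.
apply/negP => zW; case/negP: Qe.
have [f zf] := finField_prim_rootP gP z0.
have : g ^+ (Q.-1 * (e + f * Q.+1)) = 1.
  move: zW; have -> : u * g ^+ e * z + (u * g ^+ e) ^+ Q * z ^+ (Q ^ 2)
      = u * g ^+ e * z * (1 - g ^+ (Q.-1 * (e + f * Q.+1))).
    have -> : g ^+ (Q.-1 * (e + f * Q.+1)) = (g ^+ e) ^+ Q.-1 * z ^+ (Q.-1 * Q.+1).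
      by rewrite zf -!exprM -exprD mulnDr [(Q.-1 * e)%N]mulnC mulnCA.
    rewrite [(u * g ^+ e) ^+ Q]exprMn uQ.
    have -> : (g ^+ e) ^+ Q = g ^+ e * (g ^+ e) ^+ Q.-1 by rewrite -exprS prednK.
    by rewrite K2 [z ^+ _.+1]exprS; ring.
  rewrite !mulf_eq0 (negPf u0) (negPf z0) expf_eq0 (negPf g0) andbF subr_eq0.
  by move/eqP.
move/eqP; rewrite -(prim_order_dvd gP) => /(dvdn_trans semiprimitive_dvdn).
by rewrite dvdn_pmul2l // dvdn_addl // dvdn_mull.
Qed.

(** The square of the sum is Q^(2t) times Q^2 or 1, so the sum is a power of -Q with exponent t +
    [Q+1 | e]. The extra factor -Q is the bracket 1 - (Q+1). *)
Lemma hermitian_sum e :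
  power_sum psi Q.+1 (u * g ^+ e)
    = (- Q%:R) ^+ t * (1 - (Q.+1 * (Q.+1 %| e))%:R).
Proof.
have Q_gt1 := semiprimitive_gt1.
have QN : (Q.+1 %| N)%N := dvdn_trans (dvdn_mull _ (dvdnn _)) semiprimitive_dvdn.
have [T TA ST] := Aint_power_sum_quotient (u * g ^+ e) QN psi_Aint psi0 isT.
rewrite (@Aint_square_sign (power_sum psi Q.+1 _) T Q (t + (Q.+1 %| e)) Q_gt1) //.
  rewrite exprD; congr (_ * _); case: dvdn; rewrite ?muln1 ?muln0 ?subr0 //.
  by rewrite -natr1 opprD addrCA subrr addr0.
have SQ := hermitian_sum_sqr (u * g ^+ e) charF cardF t_gt0 semiprimitive_dvdn.
rewrite SQ // card_hermitian_radical semiprimitive_card -natrX -natrM.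
by rewrite -expnM -expnD mulnDl [(t * 2)%N]mulnC [(_ * 2)%N]mulnC.
Qed.

(** Averaging the Hermitian sum over the twists by w^m yields S_m, because x^(Q+1) is itself an m-th
    power and can be absorbed into w. The same averaging applied to the brackets turns Q + 1 into
    d. *)
Lemma semiprimitive_power_sum m e : (0 < m)%N -> (gcdn m N %| Q.+1)%N ->
  power_sum psi m (u * g ^+ e)
    = (- Q%:R) ^+ t * (1 - (gcdn m N * (gcdn m N %| e))%:R).
Proof.
move=> m_gt0; set d := gcdn m N => dQ.
have Q_gt1 := semiprimitive_gt1; have N_gt0 := prim_order_gt0 gP.
have QN : (Q.+1 %| N)%N := dvdn_trans (dvdn_mull _ (dvdnn _)) semiprimitive_dvdn.
have [w wP] := C_prim_root_exists N_gt0.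
have [r Qr] := dvdnP dQ; have d_gt0 : (0 < d)%N by rewrite gcdn_gt0 N_gt0 orbT.
have r_gt0 : (0 < r)%N by case: (r) Qr.
have zP := dvdn_prim_root wP QN; set z := w ^+ _ in zP.
have sum_bracket k v e' : k.-primitive_root v ->
    (k * (k %| e'))%:R = \sum_(a < k) v ^+ (a * e') :> algC.
  by move=> vP; rewrite (sum_prim_root_expr _ vP); case: ifP; rewrite ?muln1 ?muln0.
have N0 : N%:R != 0 :> algC by rewrite pnatr_eq0 -lt0n.
have averaging : N%:R * power_sum psi m (u * g ^+ e)
    = \sum_(f < N) power_sum psi Q.+1 (u * g ^+ (e + f * m)).
  rewrite [RHS]exchange_big /= [RHS](bigD1 0) //= expr0n /=.
  under [X in _ = X + _]eq_bigr => f _ do rewrite mulr0 psi0.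
  rewrite sumr_const card_ord.
  pose f v := psi (u * g ^+ e * v ^+ m).
  have f0 : f 0 = 1 by rewrite /f expr0n gtn_eqF ?mulr0 ?psi0.
  have sum_f (c : F) : c != 0 -> \sum_(i < N) f (g ^+ i * c) = \sum_v f v - 1.
    move=> c0; rewrite -(big_finField_prim (fun v => f (v * c)) gP).
    rewrite [in RHS](reindex_inj (mulIf c0)) [in RHS](bigD1 0) //= mul0r f0.
    by rewrite [RHS]addrC addKr.
  rewrite (eq_bigr (fun=> \sum_v f v - 1)) => [|x x0]; last first.
    (* By Bezout km m = d modulo N, and r d = Q + 1; so w -> w x^(km r) multiplies w^m by
       x^(Q+1). *)
    have [km kn kmE _] := egcdnP N m_gt0.
    rewrite -(sum_f (x ^+ (km * r))) ?expf_neq0 //; apply: eq_bigr => i _.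
    have xN : x ^+ N = 1.
      by have [j ->] := finField_prim_rootP gP x0; rewrite exprAC (prim_expr_order gP) expr1n.
    rewrite /f; congr psi; rewrite exprD -!mulrA exprMn -!exprM.
    rewrite [(km * r)%N]mulnC -[(r * km * m)%N]mulnA kmE mulnDr -Qr mulnA.
    by rewrite exprD [x ^+ (_ * N)]exprM [x ^+ _ ^+ N]exprAC xN expr1n mul1r.
  rewrite (big_finField_prim _ gP) sumr_const card_ord -[(_ - 1) *+ _]mulr_natl.
  by rewrite mulrBr mulr1 addrC subrK.
apply: (mulfI N0); rewrite averaging.
under eq_bigr => f _ do rewrite hermitian_sum (sum_bracket _ _ _ zP).
rewrite -mulr_sumr mulrCA; congr (_ * _).
rewrite sumrB sumr_const card_ord mulrBr mulr1; congr (_ - _).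
rewrite exchange_big /=.
(* The bracket at e + f m is a sum of z^(a(e + f m)). Summing over f kills every a with Q + 1 not
   dividing a m, that is, with r not dividing a. *)
transitivity (\sum_(a < Q.+1 | (r %| a)%N) N%:R * z ^+ (a * e)).
  rewrite [RHS]big_mkcond; apply: eq_bigr => a _.
  under eq_bigr => f _ do rewrite mulnDr exprD mulnCA -[z ^+ (f * _)]exprM mulnCA.
  rewrite -mulr_sumr (sum_prim_root_expr _ wP) mulrC.
  have -> : (N %| N %/ Q.+1 * (a * m))%N = (r %| a)%N.
    rewrite -{1}(divnK QN) dvdn_pmul2l ?divn_gt0 ?(dvdn_leq N_gt0) //.
    have [m' mE] := dvdnP (dvdn_gcdl m N : d %| m)%N.
    (* As d divides Q + 1, which divides N, the gcd of m and Q + 1 is d; dividing by d makes r and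
       m/d coprime. *)
    have rm' : coprime r m'.
      rewrite /coprime -(eqn_pmul2r d_gt0) muln_gcdl mul1n -Qr -mE gcdnC.
      rewrite eqn_dvd [(d %| gcdn _ _)%N]dvdn_gcd dQ dvdn_gcdl !andbT.
      by rewrite dvdn_gcd dvdn_gcdl (dvdn_trans (dvdn_gcdr _ _) QN).
    by rewrite mE mulnA [X in (X %| _)%N]Qr dvdn_pmul2r // Gauss_dvdl.
  by case: ifP => _; rewrite ?mul0r.
(* The surviving a = r a' involve z^r, of order d, so they reassemble into the bracket for d. *)
have vP := dvdn_prim_root zP dQ.
rewrite -mulr_sumr (sum_bracket _ _ _ vP); congr (_ * _).
rewrite mulnC in Qr; have := sum_multiples (fun a => z ^+ (a * e)) d r_gt0.
rewrite -Qr => ->; apply: eq_bigr => a _.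
by rewrite Qr mulKn // -exprM mulnA [(r * a)%N]mulnC.
Qed.
End SemiprimitiveSums.

(** * Zeros of diagonal forms *)

Lemma ratio_is_int (a N : nat) : (0 < N)%N ->
  ((a%:R / N%:R : rat) \is a Num.int) = (N %| a)%N.
Proof.
move=> N_gt0; have N0 : N%:R != 0 :> rat by rewrite pnatr_eq0 -lt0n.
apply/intrP/dvdnP => [[z zE] | [c ->]]; last first.
  by exists c%:Z; rewrite natrM mulfK.
exists `|z|%N; have : a%:Z = z * N%:Z.
  apply: (@intr_inj rat); rewrite rmorphM /= -zE; by rewrite divfK.
by move/(congr1 absz); rewrite abszM.
Qed.

(** Each bracket is minus the sum of w^(e a N/d_i) over 0 < a < d_i, the term a = 0 cancelling the
    1. Expanding the product and summing over e keeps the families with N dividing the sum of a_i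
    N/d_i. The point [i0] makes the common range of the a_i nonempty. *)
Lemma sum_prod_brackets (T : finType) (d : T -> nat) (S : {set T}) (N : nat) (i0 : T) :
  (0 < N)%N -> (forall i, 0 < d i)%N -> (forall i, d i %| N)%N ->
  \sum_(e < N) \prod_(i in S) (1 - (d i * (d i %| e))%:Z)
    = (-1) ^+ #|S| * N%:Z * (Ion d S)%:Z.
Proof.
move=> N_gt0 d_gt0 dN; have [w wP] := C_prim_root_exists N_gt0.
apply: (@intr_inj algC); rewrite rmorph_sum !rmorphM rmorphXn rmorphN1 /=.
have max_gt0 : (0 < \max_i d i)%N by apply: leq_trans (leq_bigmax i0).
pose j0 := Ordinal max_gt0.
pose Q i : pred 'I_(\max_i d i) := fun a => (0 < a)%N && (a < d i)%N.
have bracket i e : ((1 - (d i * (d i %| e))%:Z)%:~R : algC)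
    = - \sum_(a | Q i a) w ^+ (e * (a * (N %/ d i))).
  have dP := dvdn_prim_root wP (dN i).
  have := sum_prim_root_expr e dP; have le_d : (d i <= \max_i d i)%N by exact: leq_bigmax.
  rewrite rmorphB /= (_ : (d i * _)%N%:~R = if (d i %| e)%N then (d i)%:R else 0); last first.
    by case: ifP; rewrite ?muln1 ?muln0.
  move=> <-; rewrite (big_ord_widen _ (fun a => (w ^+ (N %/ d i)) ^+ (a * e)) le_d).
  rewrite (bigD1 j0) //= mul0n expr0 opprD addrA subrr add0r; congr (- _).
  apply: eq_big => [a | a _]; first by rewrite /Q -lt0n andbC.
  by rewrite -exprM; congr (w ^+ _); ring.
under eq_bigr => e _.
  rewrite rmorph_prod /=; under eq_bigr => i _ do rewrite bracket.
  rewrite prodrN (big_distr_big_dep j0) /=.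
  over.
rewrite -mulr_sumr -mulrA; congr (_ * _).
rewrite exchange_big /= /Ion -sum1_card -!pmulrn natr_sum mulr_sumr.
(* The default [j0] is 0, so these families are the ones vanishing outside S that [Ion] counts. *)
rewrite [RHS](eq_bigl (fun f => (f \in pfamily j0 (mem S) Q)
   && (N %| \sum_(i in S) f i * (N %/ d i))%N)); last first.
  move=> f; rewrite inE; congr (_ && _).
    apply/forallP/pfamilyP => [fP | [/subsetP supp_f fP] i].
      split=> [|i iS]; last by have := fP i; rewrite iS.
      apply/subsetP => i; apply: contraR => iS; have := fP i.
      by rewrite ifN // => /eqP fi0; apply/eqP/val_inj.
    case: ifP => [/fP // | /negbT iS]; apply: contraR iS => fi0.
    by apply: supp_f; apply: contra fi0 => /eqP->.
  rewrite -ratio_is_int // natr_sum mulr_suml; congr (_ \is a _).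
  apply: eq_bigr => i _; rewrite natrM -mulrA; congr (_ * _).
  have di0 : (d i)%:R != 0 :> rat by rewrite pnatr_eq0 -lt0n.
  by apply: (mulfI di0); rewrite divff // mulrA -natrM mulnC divnK // divff // pnatr_eq0 -lt0n.
rewrite [RHS]big_mkcondr; apply: eq_bigr => f _.
under eq_bigr => e _ do rewrite prodrXr -big_distrr /=.
by rewrite (sum_prim_root_expr _ wP) mulr1.
Qed.

(** In the bracket sum with N = D, the bracket is 1 - D at e = 0 and 1 at the other D - 1 values of
    e. *)
Lemma Ion_const (T : finType) (d : T -> nat) (S : {set T}) (D : nat) (i0 : T) :
  (0 < D)%N -> (forall i, d i = D) ->
  (Ion d S)%:R = ((D%:R - 1) ^+ #|S| + (-1) ^+ #|S| * (D%:R - 1)) / D%:R :> rat.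
Proof.
move=> D_gt0 dD; have D0 : D%:R != 0 :> rat by rewrite pnatr_eq0 -lt0n.
have d_gt0 i : (0 < d i)%N by rewrite dD.
have dvdD i : (d i %| D)%N by rewrite dD.
have /(congr1 (fun z : int => z%:~R : rat)) := sum_prod_brackets S i0 D_gt0 d_gt0 dvdD.
rewrite rmorph_sum !rmorphM rmorphXn rmorphN1 /= (bigD1 (Ordinal D_gt0)) //=.
under eq_bigr => i _ do rewrite dD dvdn0 muln1.
rewrite prodr_const rmorphXn rmorphB /= (eq_bigr (fun=> 1)) => [|e e0]; last first.
  rewrite big1 // => i _; rewrite dD /dvdn modn_small //.
  by rewrite (_ : (e == 0 :> nat)%N = false) ?muln0 ?subr0 // -(negPf e0) -val_eqE.
rewrite sumr_const cardC1 card_ord -subn1 natrB // -[1 - _]opprB.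
rewrite [(- (_ - 1)) ^+ _]exprNn -!pmulrn => E.
apply: (mulIf D0); rewrite divfK //.
have sg : (-1 : rat) ^+ #|S| * (-1) ^+ #|S| = 1 by rewrite -exprMn mulrNN mulr1 expr1n.
transitivity ((-1) ^+ #|S| * ((-1) ^+ #|S| * D%:R * (Ion d S)%:R) : rat).
  by rewrite !mulrA sg mul1r mulrC.
by rewrite -[X in _ * X]E mulrDr mulrA sg mul1r.
Qed.

(** Orthogonality in y detects the zeros. The predicate A serves both for all tuples and for those
    without zero entry. *)
Lemma count_by_characters (F : finFieldType) (psi : F -> algC) (n : nat)
    (m : 'I_n -> nat) (A : pred F) :
  {morph psi : x y / x + y >-> x * y} -> psi 0 = 1 -> (exists x, psi x != 1) ->
  #|F|%:R * #|[set x : {ffun 'I_n -> F} | [forall i, A (x i)]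
                 && (\sum_i x i ^+ m i == 0)]|%:R
    = \sum_y \prod_i \sum_(x | A x) psi (y * x ^+ m i).
Proof.
move=> psiD psi0 psi_nt.
under [RHS]eq_bigr => y _ do rewrite bigA_distr_big.
rewrite exchange_big /= mulr_natr -sumr_const.
rewrite [RHS](eq_bigr (fun x : {ffun 'I_n -> F} =>
   if \sum_i x i ^+ m i == 0 then #|F|%:R else 0)) => [|x _].
  by rewrite -big_mkcondr /=; apply: eq_bigl => x; rewrite inE; congr (_ && _).
transitivity (\sum_y psi (y * \sum_i x i ^+ m i)).
  by apply: eq_bigr => y _; rewrite mulr_sumr (big_morph psi psiD psi0).
exact: sum_additive_character.
Qed.

(** In the character sum y = 0 gives the leading power, and the other y are the u g^e. Their factors
    are eps times a bracket, minus 1 when x = 0 is excluded; the latter products expand over the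
    subsets S. *)
Lemma semiprimitive_zero_count (F : finFieldType) (p l t n : nat) (m : 'I_n -> nat) :
  p \in [pchar F] -> #|F| = (p ^ (2 * l * t))%N -> (0 < l)%N -> (0 < t)%N ->
  (0 < n)%N -> (forall i, 0 < m i)%N ->
  (forall i, gcdn (m i) #|F|.-1 %| (p ^ l).+1)%N ->
  let d i := gcdn (m i) #|F|.-1 in
  let eps : int := (- (p ^ l)%:Z) ^+ t in
  #|F|%:Z * #|[set x : {ffun 'I_n -> F} | \sum_i x i ^+ m i == 0]|%:Z
    = #|F|%:Z ^+ n + (-1) ^+ n * #|F|.-1%:Z * (eps ^+ n * (Ion d setT)%:Z) /\
  #|F|%:Z * #|[set x : {ffun 'I_n -> F} | [forall i, x i != 0]
                 && (\sum_i x i ^+ m i == 0)]|%:Z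
    = #|F|.-1%:Z ^+ n + (-1) ^+ n * #|F|.-1%:Z
        * \sum_(S : {set 'I_n}) eps ^+ #|S| * (Ion d S)%:Z.
Proof.
move=> charF cardF l_gt0 t_gt0 n_gt0 m_gt0 dQ d eps.
have [psi [psiD psi_frob psi_nt psi_A psi_tr]] := frob_additive_character charF cardF.
have [g gP] := finField_prim_root F; have N_gt0 := prim_order_gt0 gP.
have p_pr := pcharf_prime charF.
have psi0 : psi 0 = 1.
  apply: psi_tr; rewrite big1 // => i _.
  by rewrite expr0n gtn_eqF // expn_gt0 prime_gt0.
have N1 : (-1 : F) ^+ (p ^ l).+1 = 1.
  have [p2 | p_odd] := even_prime p_pr.
    by rewrite oppr_pchar2 ?expr1n // -p2.
  by rewrite -signr_odd /= oddX p_odd orbT.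
have QN := semiprimitive_dvdn charF cardF l_gt0.
(* This produces u with u^(Q-1) = -1, as the evaluation of the power sums demands. *)
rewrite mulnC in QN; have [j] := unity_root_extraction gP QN N1.
set u := g ^+ j => uP.
have u0 : u != 0.
  by rewrite expf_neq0 // (prim_root_eq0 gP) -lt0n.
pose B i e : int := 1 - (d i * (d i %| e))%:Z.
have psB i e : power_sum psi (m i) (u * g ^+ e) = (eps * B i e)%:~R.
  rewrite (semiprimitive_power_sum charF cardF l_gt0 t_gt0) //.
  by rewrite /B /eps [RHS]rmorphM [in RHS]rmorphXn [in RHS]rmorphB /= [in RHS]rmorphN.
have sum_orbit (f : F -> algC) : \sum_y f y = f 0 + \sum_(e < #|F|.-1) f (u * g ^+ e).
  rewrite -(big_finField_prim (fun v => f (u * v)) gP) (reindex_inj (mulfI u0)).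
  by rewrite (bigD1 0) //= mulr0.
have d_gt0 i : (0 < d i)%N by rewrite gcdn_gt0 m_gt0.
have dN i : (d i %| #|F|.-1)%N by apply: dvdn_gcdr.
have sumB S := sum_prod_brackets S (Ordinal n_gt0) N_gt0 d_gt0 dN.
split; apply: (@intr_inj algC).
  have := count_by_characters m predT psiD psi0 psi_nt.
  rewrite [X in _ * X%:R](_ : _ =
    #|[set x : {ffun 'I_n -> F} | \sum_i x i ^+ m i == 0]|); last first.
    by apply: eq_card => x; rewrite !inE; case: forallP => // -[].
  rewrite rmorphM /= -!pmulrn => ->.
  rewrite sum_orbit rmorphD rmorphXn /=; congr (_ + _).
    rewrite (eq_bigr (fun=> #|F|%:R)) => [|i _]; first by rewrite prodr_const card_ord.
    by under eq_bigr do rewrite mul0r psi0; rewrite sumr_const.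
  transitivity ((\sum_(e < #|F|.-1) \prod_(i in setT) (eps * B i e))%:~R : algC).
    rewrite rmorph_sum; apply: eq_bigr => e _; rewrite rmorph_prod /=.
    by apply: eq_big => [i | i _]; rewrite ?inE // -psB.
  congr _%:~R; under eq_bigr => e _ do rewrite big_split prodr_const cardsT card_ord.
  by rewrite -mulr_sumr sumB cardsT card_ord; ring.
have := count_by_characters m (predC1 0) psiD psi0 psi_nt.
rewrite rmorphM /= -!pmulrn => ->.
rewrite sum_orbit rmorphD rmorphXn /=; congr (_ + _).
  rewrite (eq_bigr (fun=> #|F|.-1%:R)) => [|i _]; first by rewrite prodr_const card_ord.
  by under eq_bigr do rewrite mul0r psi0; rewrite sumr_const cardC1.
transitivity ((\sum_(e < #|F|.-1) \prod_i (eps * B i e + -1))%:~R : algC).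
  rewrite rmorph_sum; apply: eq_bigr => e _; rewrite rmorph_prod /=.
  apply: eq_bigr => i _; rewrite rmorphD rmorphN1 /= -psB /power_sum [in RHS](bigD1 0) //=.
  by rewrite expr0n gtn_eqF // mulr0 psi0 [RHS]addrC addKr.
have prodD e : \prod_i (eps * B i e + -1)
    = \sum_(S in {set 'I_n}) \prod_i (if i \in S then eps * B i e else -1).
  exact: (bigA_distr _ _ (fun i => eps * B i e) (fun=> -1)).
congr _%:~R.
transitivity (\sum_(S in {set 'I_n}) \sum_(e < #|F|.-1)
                \prod_i (if i \in S then eps * B i e else -1)).
  by rewrite exchange_big; apply: eq_bigr => e _; exact: prodD.
rewrite mulr_sumr; apply: eq_big => [S | S _]; first by rewrite inE.
transitivity ((-1) ^+ #|~: S| * eps ^+ #|S|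
     * \sum_(e < #|F|.-1) \prod_(i in S) B i e).
  rewrite mulr_sumr; apply: eq_bigr => e _.
  rewrite (bigID (mem S)) /= mulrC -mulrA; congr (_ * _).
    rewrite -prodr_const; apply: eq_big => [i | i /negPf->] //.
    by rewrite inE.
  rewrite -prodr_const -big_split; apply: eq_bigr => i iS.
  by rewrite iS.
(* One sign comes from the brackets on S, the other from the factors -1 off S. *)
have -> : (-1) ^+ n = (-1) ^+ #|S| * (-1) ^+ #|~: S| :> int.
  by rewrite -exprD cardsC card_ord.
by rewrite sumB; ring.
Qed.

(** * The torus action *)

Lemma gcd_exponent_closed (F : fieldType) (P : F -> Prop) (x : F) (a b : nat) :
  x != 0 -> (forall y z, P y -> P z -> P (y * z)) -> (forall y, P y -> P y^-1) -> P 1 ->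
  P (x ^+ a) -> P (x ^+ b) -> P (x ^+ gcdn a b).
Proof.
move=> x0 PM PV P1 Pa Pb; case: (posnP a) => [-> | a_gt0]; first by rewrite gcd0n.
have PX y n : P y -> P (y ^+ n).
  by move=> Py; elim: n => [|n IHn]; rewrite ?expr0 // exprS; apply: PM.
have [ka kb kE _] := egcdnP b a_gt0.
have -> : x ^+ gcdn a b = (x ^+ a) ^+ ka * ((x ^+ b) ^+ kb)^-1.
  rewrite -!exprM [(a * _)%N]mulnC kE [(b * _)%N]mulnC exprD mulrC mulKf //.
  exact: expf_neq0.
by apply: PM; [apply: PX | apply/PV/PX].
Qed.

Lemma card_roots_of_power (F : finFieldType) (K : nat) (z : F) :
  (K %| #|F|.-1)%N -> z != 0 -> #|[set v : F | v ^+ K == z ^+ K]| = K.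
Proof.
move=> KN z0; have K_gt0 : (0 < K)%N.
  by apply: dvdn_gt0 KN; have [g /prim_order_gt0] := finField_prim_root F.
rewrite -(card_preimset _ (mulIf z0)).
apply: succn_inj; rewrite -[RHS](card_expr_fixed KN) [RHS](cardsD1 0) !inE.
rewrite expr0n eqxx add1n; congr _.+1; apply: eq_card => v; rewrite !inE.
rewrite exprMn -{2}[z ^+ K]mul1r (inj_eq (mulIf (expf_neq0 _ z0))).
have [-> | v0] /= := eqVneq v 0.
  by rewrite expr0n gtn_eqF // eq_sym oner_eq0.
by rewrite exprS -[X in _ = (_ == X)]mulr1 (inj_eq (mulfI v0)).
Qed.

Definition torus_solutions (F : finFieldType) (n : nat) (m kk : 'I_n -> nat)
    (k : nat) (c : F) : {set {ffun 'I_n -> F}} :=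
  [set x : {ffun 'I_n -> F} | [forall i, x i != 0] && (\sum_i x i ^+ m i != 0)
     && ((\sum_i x i ^+ m i) ^+ k == c * \prod_i x i ^+ kk i)].

(** The ratios mu^k / prod_i h_i^(k_i) over the torus, written without division; they form a
    subgroup of the multiplicative group. *)
Definition torus_shift (F : finFieldType) (n : nat) (m kk : 'I_n -> nat)
    (k : nat) (c : F) : Prop :=
  exists h : 'I_n -> F, exists mu : F,
    [/\ forall i, h i != 0, mu != 0, forall i, h i ^+ m i = mu
      & c * \prod_i h i ^+ kk i = mu ^+ k].

(** Multiplying x by h scales the left side by mu^k and the product by mu^k / a, so it matches
    solutions for c with solutions for a c. *)
Lemma card_torus_shift (F : finFieldType) (n : nat) (m kk : 'I_n -> nat)
    (k : nat) (a c : F) : torus_shift m kk k a ->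
  #|torus_solutions m kk k (a * c)| = #|torus_solutions m kk k c|.
Proof.
move=> [h [mu [h0 mu0 hm hk]]].
pose f (x : {ffun 'I_n -> F}) := [ffun i => x i * h i].
have f_inj : injective f.
  move=> x y /ffunP fxy; apply/ffunP => i; have := fxy i.
  by rewrite !ffunE => /(mulIf (h0 i)).
rewrite -(card_preimset _ f_inj); apply: eq_card => x; rewrite !inE.
have -> : \sum_i f x i ^+ m i = mu * \sum_i x i ^+ m i.
  rewrite mulr_sumr; apply: eq_bigr => i _.
  by rewrite ffunE exprMn hm mulrC.
have -> : \prod_i f x i ^+ kk i = \prod_i x i ^+ kk i * \prod_i h i ^+ kk i.
  by rewrite -big_split; apply: eq_bigr => i _; rewrite ffunE exprMn.
congr (_ && _ && _).
- by apply: eq_forallb => i; rewrite ffunE mulf_eq0 (negPf (h0 i)) orbF.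
- by rewrite mulf_eq0 (negPf mu0).
rewrite exprMn -hk.
have -> : a * c * (\prod_i x i ^+ kk i * \prod_i h i ^+ kk i)
        = a * \prod_i h i ^+ kk i * (c * \prod_i x i ^+ kk i) by ring.
by rewrite (inj_eq (mulfI _)) // hk expf_neq0.
Qed.

Lemma torus_shift1 (F : finFieldType) (n : nat) (m kk : 'I_n -> nat) (k : nat) :
  torus_shift m kk k (1 : F).
Proof.
exists (fun=> 1), 1; split=> [i||i|]; rewrite ?oner_eq0 ?expr1n //.
by rewrite mul1r big1 // => i _; rewrite expr1n.
Qed.

Lemma torus_shiftM (F : finFieldType) (n : nat) (m kk : 'I_n -> nat) (k : nat)
    (a c : F) :
  torus_shift m kk k a -> torus_shift m kk k c -> torus_shift m kk k (a * c).
Proof.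
move=> [h [mu [h0 mu0 hm hk]]] [h' [mu' [h'0 mu'0 hm' hk']]].
exists (fun i => h i * h' i), (mu * mu'); split=> [i||i|].
- by rewrite mulf_neq0.
- by rewrite mulf_neq0.
- by rewrite exprMn hm hm'.
rewrite exprMn -hk -hk'; under eq_bigr do rewrite exprMn.
by rewrite big_split /=; ring.
Qed.

Lemma torus_shiftV (F : finFieldType) (n : nat) (m kk : 'I_n -> nat) (k : nat)
    (a : F) : torus_shift m kk k a -> torus_shift m kk k a^-1.
Proof.
move=> [h [mu [h0 mu0 hm hk]]]; exists (fun i => (h i)^-1), mu^-1; split=> [i||i|].
- by rewrite invr_eq0.
- by rewrite invr_eq0.
- by rewrite exprVn hm.
rewrite exprVn -hk invfM; congr (_ * _).
by rewrite -prodfV; apply: eq_bigr => i _; rewrite exprVn.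
Qed.

Lemma muln_divn_mul (a b c e : nat) : (0 < c)%N -> (0 < e)%N ->
  (c %| a)%N -> (e %| b)%N -> (c * ((a * b) %/ (c * e)) = (b %/ e) * a)%N.
Proof.
move=> c_gt0 e_gt0 /dvdnP[a' ->] /dvdnP[b' ->].
have -> : (a' * c * (b' * e) = a' * b' * (c * e))%N by ring.
by rewrite !mulnK ?muln_gt0 ?c_gt0 //; ring.
Qed.

(** The exponents a for which (g^k0)^a is a shift are closed under gcd, so it suffices to realize
    each entry of the gcd hypothesis. *)
Lemma torus_shift_gcd (F : finFieldType) (n : nat) (m kk : 'I_n -> nat)
    (k k0 M : nat) (g : F) : #|F|.-1.-primitive_root g ->
  (0 < k0)%N -> (k0 %| k)%N -> (forall i, k0 %| kk i)%N -> (k0 %| #|F|.-1)%N ->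
  (forall i, 0 < m i)%N -> (forall i, m i %| M)%N ->
  let d i := gcdn (m i) #|F|.-1 in
  gcdn `|((\sum_(j < n) (kk j * M) %/ (k0 * m j))%N%:Z - ((k * M) %/ k0)%N%:Z)|%N
    (gcdn (\big[gcdn/0%N]_(j < n) ((kk j * #|F|.-1) %/ (k0 * d j))%N) (#|F|.-1 %/ k0)%N)
    = 1%N ->
  torus_shift m kk k (g ^+ k0).
Proof.
move=> gP k0_gt0 k0k k0kk k0N m_gt0 mM d gcd1.
have g0 : g != 0 by rewrite (prim_root_eq0 gP) -lt0n (prim_order_gt0 gP).
set x := g ^+ k0; have x0 : x != 0 by rewrite expf_neq0.
have gcd_closed a b : torus_shift m kk k (x ^+ a) -> torus_shift m kk k (x ^+ b) ->
    torus_shift m kk k (x ^+ gcdn a b).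
  apply: gcd_exponent_closed => //.
  - exact: torus_shiftM.
  - exact: torus_shiftV.
  - exact: torus_shift1.
have shift0 : torus_shift m kk k (x ^+ 0) by rewrite expr0; apply: torus_shift1.
rewrite -[x]expr1 -gcd1; apply: (gcd_closed); last apply: (gcd_closed).
- set A1 := (\sum_(j < n) _)%N; set A2 := (_ %/ k0)%N.
  have shiftA : torus_shift m kk k (x ^+ A2 / x ^+ A1).
    (* This torus element has h_i^(m_i) = g^M for all i; its ratio realizes the difference in the
       first entry, up to sign, and inversion takes care of the absolute value. *)
    exists (fun i => g ^+ (M %/ m i)), (g ^+ M); split=> [i||i|].
    + by rewrite expf_neq0.
    + by rewrite expf_neq0.
    + by rewrite -exprM divnK.
    rewrite (_ : \prod_i _ = x ^+ A1); last first.
      rewrite -prodrXr; apply: eq_bigr => i _; rewrite -!exprM; congr (g ^+ _).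
      exact/esym/muln_divn_mul.
    rewrite divfK ?expf_neq0 // -!exprM; congr (g ^+ _).
    by rewrite mulnC divnK 1?mulnC // dvdn_mull.
  case: (leqP A1 A2) => [le12 | /ltnW le21].
    have xE : x ^+ A2 = x ^+ (A2 - A1) * x ^+ A1 by rewrite -exprD subnK.
    by move: shiftA; rewrite distnEr // xE mulfK // expf_neq0.
  have xE : x ^+ A1 = x ^+ (A1 - A2) * x ^+ A2 by rewrite -exprD subnK.
  have := torus_shiftV shiftA; rewrite distnEl // invf_div xE mulfK //.
  exact: expf_neq0.
- elim/big_ind: _ => // j _.
  (* The j-th coordinate is a root of unity of order d_j, so mu = 1. Its ratio is the inverse of the
     desired power, hence the inversion below. *)
  pose h i := if i == j then g ^+ (#|F|.-1 %/ d j) else 1.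
  rewrite -[_ ^+ _]invrK; apply: torus_shiftV.
  exists h, 1; split=> [i||i|].
  + by rewrite /h; case: (i == j); [exact: expf_neq0 | exact: oner_neq0].
  + exact: oner_neq0.
  + rewrite /h; case: eqP => [->|_]; last by rewrite expr1n.
    rewrite -exprM; apply/eqP; rewrite -(prim_order_dvd gP).
    have [c mE] := dvdnP (dvdn_gcdl (m j) #|F|.-1 : d j %| m j)%N.
    by rewrite mE mulnCA divnK ?dvdn_mull // dvdn_gcdr.
  rewrite (bigD1 j) //= big1 => [|i /negPf ij]; last by rewrite /h ij expr1n.
  rewrite /h eqxx mulr1 expr1n -!exprM.
  rewrite muln_divn_mul ?dvdn_gcdr ?gcdn_gt0 ?m_gt0 // mulVf // expf_neq0 //.
rewrite -exprM mulnC divnK // (prim_expr_order gP); exact: torus_shift1.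
Qed.

(** Pairs (v, x) with v nonzero and x a torus solution for v^k0 are counted twice: every v has
    equally many x, and every x has exactly k0 values v. *)
Lemma card_torus_solutions (F : finFieldType) (n : nat) (m kk : 'I_n -> nat)
    (k k0 : nat) (y g : F) : #|F|.-1.-primitive_root g ->
  (0 < k0)%N -> (k0 %| k)%N -> (forall i, k0 %| kk i)%N -> (k0 %| #|F|.-1)%N ->
  torus_shift m kk k (g ^+ k0) -> y != 0 ->
  (#|F|.-1 * #|torus_solutions m kk k (y ^+ k0)%R|)%N
   = (k0 * #|[set x : {ffun 'I_n -> F} |
        ([forall i, x i != 0] && (\sum_i x i ^+ m i != 0))%R]|)%N.
Proof.
move=> gP k0_gt0 k0k k0kk k0N shift_g y0.
have card_pow (v : F) : v != 0 ->
    #|torus_solutions m kk k (v ^+ k0)| = #|torus_solutions m kk k (1 : F)|.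
  move=> v0; have [e ->] := finField_prim_rootP gP v0.
  rewrite -[X in torus_solutions _ _ _ X]mulr1; apply: card_torus_shift.
  elim: (e : nat) => [|i IHi]; first by rewrite expr0 expr1n; apply: torus_shift1.
  by rewrite exprS exprMn; apply: torus_shiftM.
rewrite card_pow //; set X := [set x | _].
transitivity (\sum_(v : F | v != 0%R) #|torus_solutions m kk k (v ^+ k0)%R|)%N.
  by rewrite [RHS](eq_bigr _ card_pow) sum_nat_const cardC1.
transitivity (\sum_(x in X) #|[set v : F | ((v != 0) &&
    ((\sum_i x i ^+ m i) ^+ k == v ^+ k0 * \prod_i x i ^+ kk i))%R]|)%N.
  pose E (x : {ffun 'I_n -> F}) (v : F) :=
    (\sum_i x i ^+ m i) ^+ k == v ^+ k0 * \prod_i x i ^+ kk i.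
  transitivity (\sum_(v : F | v != 0%R) \sum_(x in X | E x v) 1)%N.
    by apply: eq_bigr => v _; rewrite -sum1_card; apply: eq_bigl => x; rewrite !inE.
  rewrite (exchange_big_dep (mem X)) /= => [|v x _ /andP[] //].
  apply: eq_bigr => x xX; rewrite -sum1_card; apply: eq_bigl => v.
  by rewrite [RHS]inE [x \in X]xX.
rewrite (eq_bigr (fun=> k0)) => [|x]; first by rewrite sum_nat_const mulnC.
rewrite inE => /andP[/forallP x0 T0].
(* As k0 divides all the exponents, the coefficient required by x is z^k0; since k0 divides N, it
   has k0 roots v. *)
pose z := (\sum_i x i ^+ m i) ^+ (k %/ k0) / \prod_i x i ^+ (kk i %/ k0).
have P0 : \prod_i x i ^+ kk i != 0 by apply/prodf_neq0 => i _; rewrite expf_neq0.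
have z0 : z != 0.
  rewrite mulf_neq0 ?expf_neq0 // invr_eq0.
  by apply/prodf_neq0 => i _; rewrite expf_neq0.
rewrite -[RHS](card_roots_of_power k0N z0); apply: eq_card => v; rewrite !inE.
have -> : (\sum_i x i ^+ m i) ^+ k = z ^+ k0 * \prod_i x i ^+ kk i.
  rewrite exprMn exprVn -exprM divnK // -prodrXl.
  under [X in _ / X]eq_bigr => i _ do rewrite -exprM divnK //.
  by rewrite divfK.
rewrite [X in _ && X]eq_sym (inj_eq (mulIf P0)); apply: andb_idl; apply: contraTneq => ->.
by rewrite expr0n gtn_eqF // eq_sym expf_neq0.
Qed.

(** With a zero entry the product vanishes, so solving the equation means T(x) = 0; without one, a
    solution has T(x) nonzero. The zeros of T without zero entry are added on the left to avoid
    natural subtraction. *)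
Lemma Nsol_torus (F : finFieldType) (n : nat) (b : F) (k : nat) (kk m : 'I_n -> nat) :
  (0 < k)%N -> (forall i, 0 < kk i)%N -> b != 0 ->
  (Nsol b k kk m + #|[set x : {ffun 'I_n -> F} |
       ([forall i, x i != 0] && (\sum_i x i ^+ m i == 0))%R]|
   = #|torus_solutions m kk k b|
     + #|[set x : {ffun 'I_n -> F} | (\sum_i x i ^+ m i == 0)%R]|)%N.
Proof.
move=> k_gt0 kk_gt0 b0.
rewrite -!sum1_card /Nsol -sum1_card ![(\sum_(i in _) 1)%N]big_mkcond -!big_split.
apply: eq_bigr => x _; rewrite !inE.
case: (boolP [forall i, x i != 0]) => [x0 | /forallPn[i]] /=.
  have P0 : b * \prod_i x i ^+ kk i != 0.
    rewrite mulf_neq0 //; apply/prodf_neq0 => i _.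
    by rewrite expf_neq0 // (forallP x0).
  case: (eqVneq (\sum_i x i ^+ m i) 0) => [T0 | T0] /=; last by rewrite addn0.
  rewrite T0 expr0n gtn_eqF //.
  by rewrite eq_sym (negPf P0).
rewrite negbK => /eqP xi.
have -> : \prod_i x i ^+ kk i = 0.
  by rewrite (bigD1 i) //= xi expr0n gtn_eqF ?mul0r.
by rewrite mulr0 expf_eq0 k_gt0 addn0.
Qed.

(** * The number of solutions *)

(** In effect p has order 2l modulo D: the remainder r of s modulo 2l still satisfies D | p^r - 1,
    and a nonzero r is impossible. *)
Lemma semiprimitive_order (p l s D : nat) : (0 < p)%N -> (0 < l)%N -> (2 < D)%N ->
  (D %| p ^ l + 1)%N -> (forall l', 0 < l' -> D %| p ^ l' + 1 -> l <= l')%N ->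
  (D %| (p ^ s).-1)%N -> (2 * l %| s)%N.
Proof.
move=> p_gt0 l_gt0 D_gt2 Dl l_min Ds; set r := (s %% (2 * l))%N.
have D2l : (D %| (p ^ (2 * l)).-1)%N.
  rewrite mulnC expnM -subn1 -{2}(exp1n 2) subn_sqr; exact: dvdn_mull.
have Dr : (D %| (p ^ r).-1)%N.
  have D2la : (D %| (p ^ (2 * l * (s %/ (2 * l)))).-1)%N.
    by rewrite expnM; apply: dvdn_trans (dvdn_pred_predX _ _).
  have E : ((p ^ s).-1 = p ^ r * (p ^ (2 * l * (s %/ (2 * l)))).-1 + (p ^ r).-1)%N.
    rewrite {1}(divn_eq s (2 * l)) -/r [(_ * (2 * l))%N]mulnC addnC expnD.
    have : (0 < p ^ r)%N by rewrite expn_gt0 p_gt0.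
    have : (0 < p ^ (2 * l * (s %/ (2 * l))))%N by rewrite expn_gt0 p_gt0.
    by case: (p ^ (_ * _))%N => // a; case: (p ^ r)%N => // b _ _ /=; lia.
  by move: Ds; rewrite E dvdn_addr // dvdn_mull.
have pr_gt0 : (0 < p ^ r)%N by rewrite expn_gt0 p_gt0.
have [r0 | r_gt0] := posnP r; first by rewrite /dvdn -/r r0.
(* As p^l = -1 and p^r = 1 modulo D, unequal r and l give p^|l-r| = -1 with 0 < |l-r| < l, against
   minimality; r = l gives D | 2. *)
have [rl | lr | rl] := ltngtP r l.
- have E : (p ^ l + 1 = p ^ (l - r) * (p ^ r).-1 + (p ^ (l - r) + 1))%N.
    rewrite -{1}(subnK (ltnW rl)) expnD; case: (p ^ r)%N pr_gt0 => // a _ /=; lia.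
  move: Dl; rewrite E dvdn_addr ?dvdn_mull // => /l_min.
  by rewrite subn_gt0 => /(_ rl); move: rl r_gt0; clear; lia.
- have E : (p ^ (r - l) * (p ^ l + 1) = (p ^ r).-1 + (p ^ (r - l) + 1))%N.
    rewrite mulnDr -expnD subnK ?(ltnW lr) // muln1.
    by case: (p ^ r)%N pr_gt0 => // a _ /=; rewrite addn1 addnS addSn.
  have : (D %| p ^ (r - l) * (p ^ l + 1))%N by rewrite dvdn_mull.
  rewrite E dvdn_addr // => /l_min; rewrite subn_gt0 => /(_ lr).
  have : (r < 2 * l)%N by rewrite ltn_mod muln_gt0.
  by move: lr r_gt0; clear; lia.
have : (D %| 2)%N.
  have E : (p ^ l + 1 = (p ^ r).-1 + 2)%N by rewrite -rl -{1}(prednK pr_gt0) addSnnS.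
  by move: Dl; rewrite E dvdn_addr.
by move/dvdn_leq => /(_ isT); rewrite leqNgt D_gt2.
Qed.

Lemma Ion_set0 (T : finType) (d : T -> nat) (i0 : T) : (forall i, 0 < d i)%N ->
  Ion d set0 = 1%N.
Proof.
move=> d_gt0; set N := (\prod_i d i)%N.
have N_gt0 : (0 < N)%N by rewrite prodn_gt0.
have dN i : (d i %| N)%N by rewrite /N (bigD1 i) //= dvdn_mulr.
have := sum_prod_brackets set0 i0 N_gt0 d_gt0 dN.
under eq_bigr do rewrite big_set0.
rewrite sumr_const card_ord cards0 mul1r -[X in X = _]mulr1 => /eqP.
rewrite natz (inj_eq (mulfI _)) => [/eqP[]|]; last by rewrite -lt0n.
by [].
Qed.

Lemma Ion_set1 (T : finType) (d : T -> nat) (i : T) : (forall i, 0 < d i)%N ->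
  Ion d [set i] = 0%N.
Proof.
move=> d_gt0; apply/eqP; rewrite cards_eq0; apply/eqP/setP=> f; rewrite !inE.
apply/negP => /andP[/forallP/(_ i)]; rewrite inE eqxx => /andP[f_gt0 f_lt].
by rewrite big_set1 ratio_is_int // => /(dvdn_leq f_gt0); rewrite leqNgt f_lt.
Qed.

(** The empty set contributes 1, singletons contribute 0 and the full set is isolated, which leaves
    2 <= r < n. *)
Lemma sum_Ion_by_card (n : nat) (d : 'I_n -> nat) (eps : rat) :
  (2 <= n)%N -> (forall i, 0 < d i)%N ->
  \sum_(S : {set 'I_n}) eps ^+ #|S| * (Ion d S)%:R
    = 1 + eps ^+ n * (Ifull d)%:R
      + \sum_(2 <= r < n) eps ^+ r * \sum_(S : {set 'I_n} | #|S| == r) (Ion d S)%:R.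
Proof.
move=> n_ge2 d_gt0.
have le_card (S : {set 'I_n}) : (#|S| < n.+1)%N.
  by rewrite ltnS -[X in (_ <= X)%N]card_ord max_card.
rewrite (partition_big (fun S : {set 'I_n} => Ordinal (le_card S)) xpredT) //=.
pose G r : rat := eps ^+ r * \sum_(S : {set 'I_n} | #|S| == r) (Ion d S)%:R.
rewrite (eq_bigr (fun r : 'I_n.+1 => G r)) => [|r _]; last first.
  rewrite /G mulr_sumr; apply: eq_big => [S | S /eqP <-] //.
rewrite -(big_mkord xpredT G) big_nat_recr //= big_ltn ?(ltnW n_ge2) //.
rewrite big_ltn //.
have -> : G 0%N = 1.
  rewrite /G mul1r (eq_bigl (pred1 set0)) => [|S]; last by rewrite cards_eq0.
  by rewrite big_pred1_eq (Ion_set0 (Ordinal (ltnW n_ge2))).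
have -> : G 1%N = 0.
  rewrite /G big1 ?mulr0 // => S /cards1P[i ->].
  by rewrite Ion_set1.
have -> : G n = eps ^+ n * (Ifull d)%:R.
  rewrite /G /Ifull (eq_bigl (pred1 setT)) => [|S]; first by rewrite big_pred1_eq.
  by rewrite /= eqEcard subsetT cardsT card_ord eqn_leq -ltnS le_card.
by rewrite add0r; ring.
Qed.

(** Here Q^t is the square root of q, so q^((r-2)/2) is a natural number; the split-off q cancels
    the one multiplying the zero counts. *)
Lemma signed_prime_power_exp (Q q t r : nat) : (q = Q ^ (2 * t))%N -> (2 <= r)%N ->
  ((- Q%:R) ^+ t) ^+ r = q%:R * ((-1) ^+ (r * t) * ((Q ^ t) ^ (r - 2))%:R) :> rat.
Proof.
move=> -> r_ge2; rewrite -exprM exprNn mulnC mulrCA; congr (_ * _).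
rewrite -natrX -natrM -expnM -expnD; congr ((Q ^ _)%:R).
by rewrite [(t * _)%N]mulnC -mulnDl subnKC.
Qed.

Lemma Nsol_torus_formula (F : finFieldType) (n : nat) (b : F) (k k0 : nat)
    (kk m : 'I_n -> nat) :
  (0 < k)%N -> (forall i, 0 < kk i)%N -> b != 0 ->
  (#|F|.-1 * #|torus_solutions m kk k b|)%N
   = (k0 * #|[set x : {ffun 'I_n -> F} |
        ([forall i, x i != 0] && (\sum_i x i ^+ m i != 0))%R]|)%N ->
  let N0 := #|[set x : {ffun 'I_n -> F} | \sum_i x i ^+ m i == 0]| in
  let Nstar := #|[set x : {ffun 'I_n -> F} | [forall i, x i != 0]
                       && (\sum_i x i ^+ m i == 0)]| in
  #|F|.-1%:R * (Nsol b k kk m)%:R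
    = k0%:R * (#|F|.-1%:R ^+ n - Nstar%:R) + #|F|.-1%:R * (N0%:R - Nstar%:R) :> rat.
Proof.
move=> k_gt0 kk_gt0 b0 card_torus N0 Nstar.
have /(congr1 (fun i => i%:R : rat)) := Nsol_torus m k_gt0 kk_gt0 b0.
rewrite -/Nstar -/N0 !natrD => E1.
move/(congr1 (fun i => i%:R : rat)): card_torus; rewrite !natrM.
set X := [set x | _] => E2.
(* The tuples without zero entry split according to whether T vanishes. *)
have /(congr1 (fun i => i%:R : rat)) : (#|X| + Nstar = #|F|.-1 ^ n)%N.
  rewrite -[n in RHS]card_ord -(cardC1 (0 : F)) -card_ffun_on.
  rewrite /Nstar -!sum1_card ![(\sum_(i in _) 1)%N]big_mkcond -!big_split.
  apply: eq_bigr => x _.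
  have -> : (x \in ffun_on (predC1 (0 : F))) = [forall i, x i != 0] by [].
  by rewrite !inE; case: forallP => //= _; case: eqVneq.
rewrite natrD natrX => E3.
have -> : (Nsol b k kk m)%:R
    = #|torus_solutions m kk k b|%:R + N0%:R - Nstar%:R :> rat.
  by rewrite -E1 addrK.
by rewrite -E3 -addrA mulrDr E2 addrK.
Qed.

(** Elimination of the two zero counts: q1 stands for q^(n-1), Nn for N^n and sg for (-1)^n, while W
    and U carry the full subset and the intermediate ones. *)
Lemma solve_for_Nsol (q N q1 Nn sg k0 W U N0 Ns X : rat) :
  q != 0 -> N != 0 -> N = q - 1 ->
  q * N0 = q * q1 + N * (q * W) ->
  q * Ns = Nn + sg * N + N * (q * W) + N * (q * U) ->
  N * X = k0 * (Nn - Ns) + N * (N0 - Ns) ->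
  X = q1 - sg + (k0 - 1) * (Nn - sg) / q - k0 * W - (k0 + q - 1) * U.
Proof.
move=> q0 NN0 NE E0 Es EX.
have -> : X = (k0 * (Nn - Ns) + N * (N0 - Ns)) / N by rewrite -EX mulrC mulKf.
have -> : N0 = (q * q1 + N * (q * W)) / q by rewrite -E0 mulrC mulKf.
have -> : Ns = (Nn + sg * N + N * (q * W) + N * (q * U)) / q by rewrite -Es mulrC mulKf.
by move: NN0; rewrite NE => NN0; field; rewrite q0 NN0.
Qed.

Theorem theorem4 (F : finFieldType) (p s : nat) (n : nat) (b : F) (k : nat)
    (kk m : 'I_n -> nat) (l : nat) :
  prime p -> (p \in [pchar F]) -> #|F| = (p ^ s)%N ->
  (2 <= n)%N -> b != 0 -> (0 < k)%N ->
  (forall j, 0 < kk j)%N -> (forall j, 0 < m j)%N ->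
  let q := #|F| in
  let d := fun j => gcdn (m j) q.-1 in
  let D := \big[lcmn/1%N]_(j < n) d j in
  let M := \big[lcmn/1%N]_(j < n) m j in
  let k0 := gcdn k (gcdn (\big[gcdn/0%N]_(j < n) kk j) q.-1) in
  (exists y : F, b = y ^+ k0) ->
  (2 < D)%N ->
  (0 < l)%N -> (D %| p ^ l + 1)%N ->
  (forall l', 0 < l' -> D %| p ^ l' + 1 -> l <= l')%N ->
  gcdn `|((\sum_(j < n) (kk j * M) %/ (k0 * m j))%N%:Z - ((k * M) %/ k0)%N%:Z)|%N
    (gcdn (\big[gcdn/0%N]_(j < n) ((kk j * q.-1) %/ (k0 * d j))%N) (q.-1 %/ k0)%N)
    = 1%N ->
  let t := (s %/ (2 * l))%N in
  let qQ : rat := q%:R in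
  let sq : nat := (p ^ (s %/ 2))%N in
  (2 * l %| s)%N /\
  (Nsol b k kk m)%:R =
    qQ ^+ n.-1 - (-1) ^+ n
    + (k0%:R - 1) * ((qQ - 1) ^+ n - (-1) ^+ n) / qQ
    - (-1) ^+ (t.-1 * n) * k0%:R * (sq ^ (n - 2))%:R * (Ifull d)%:R
    - (-1) ^+ n * (k0%:R + qQ - 1) *
        \sum_(2 <= r < n) (-1) ^+ (r * t) * (sq ^ (r - 2))%:R *
          \sum_(S : {set 'I_n} | #|S| == r) (Ion d S)%:R
  /\
  ((forall j, d j = D) ->
   (Nsol b k kk m)%:R =
    qQ ^+ n.-1 - (-1) ^+ n
    + (k0%:R - 1) * ((qQ - 1) ^+ n - (-1) ^+ n) / qQ
    - (-1) ^+ (t.-1 * n) * k0%:R * (sq ^ (n - 2))%:R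
        * (((D%:R - 1) ^+ n + (-1) ^+ n * (D%:R - 1)) / D%:R)
    - (-1) ^+ n * (k0%:R + qQ - 1) *
        \sum_(2 <= r < n) (-1) ^+ (r * t) * (sq ^ (r - 2))%:R *
          ('C(n, r)%:R * (((D%:R - 1) ^+ r + (-1) ^+ r * (D%:R - 1)) / D%:R))).
Proof.
move=> p_pr charF cardF n_ge2 b0 k_gt0 kk_gt0 m_gt0 q d D M k0 [y bE].
move=> D_gt2 l_gt0 Dl l_min gcd1 t qQ sq.
have [g gP] := finField_prim_root F; have N_gt0 := prim_order_gt0 gP.
have q_gt0 : (0 < q)%N by rewrite /q; case: #|F| N_gt0.
have p_gt0 := prime_gt0 p_pr.
have n_gt0 : (0 < n)%N := ltnW n_ge2.
have d_gt0 i : (0 < d i)%N by rewrite gcdn_gt0 m_gt0.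
have dD i : (d i %| D)%N by rewrite /D (bigD1 i) //= dvdn_lcml.
have mM i : (m i %| M)%N by rewrite /M (bigD1 i) //= dvdn_lcml.
have DN : (D %| q.-1)%N by apply/dvdn_biglcmP => i _; apply: dvdn_gcdr.
have ls : (2 * l %| s)%N.
  by apply: (semiprimitive_order p_gt0 l_gt0 D_gt2 Dl l_min); rewrite -cardF.
split=> //.
have st : s = (2 * l * t)%N by rewrite mulnC divnK.
(* If t were 0, the field would have a single element. Positivity also makes [t.-1] a true t - 1. *)
have t_gt0 : (0 < t)%N.
  by rewrite lt0n; apply: contraL N_gt0 => /eqP t0; rewrite cardF st t0 muln0.
have cardF' : #|F| = (p ^ (2 * l * t))%N by rewrite -st.
have dQ i : (gcdn (m i) #|F|.-1 %| (p ^ l).+1)%N.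
  by rewrite -addn1; apply: dvdn_trans (dD i) Dl.
have k0_gt0 : (0 < k0)%N by rewrite gcdn_gt0 k_gt0.
have k0k : (k0 %| k)%N := dvdn_gcdl _ _.
have k0N : (k0 %| #|F|.-1)%N := dvdn_trans (dvdn_gcdr _ _) (dvdn_gcdr _ _).
have k0kk i : (k0 %| kk i)%N.
  apply: dvdn_trans (dvdn_gcdr _ _) (dvdn_trans (dvdn_gcdl _ _) _).
  by rewrite (bigD1 i) //= dvdn_gcdl.
have y0 : y != 0 by apply: contraNneq b0 => yE; rewrite bE yE expr0n gtn_eqF.
have shift_g := torus_shift_gcd gP k0_gt0 k0k k0kk k0N m_gt0 mM gcd1.
have card_torus := card_torus_solutions gP k0_gt0 k0k k0kk k0N shift_g y0.
rewrite -bE in card_torus.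
have := Nsol_torus_formula k_gt0 kk_gt0 b0 card_torus.
have [] := semiprimitive_zero_count charF cardF' l_gt0 t_gt0 n_gt0 m_gt0 dQ.
set N0 := #|_|; set Ns := #|_|; set eps := _ ^+ t => zero_count star_count /= EX.
pose sqE : rat := (-1) ^+ (t.-1 * n) * (sq ^ (n - 2))%:R * (Ifull d)%:R.
pose U : rat := (-1) ^+ n * \sum_(2 <= r < n) (-1) ^+ (r * t) * (sq ^ (r - 2))%:R *
          \sum_(S : {set 'I_n} | #|S| == r) (Ion d S)%:R.
have qE : q = ((p ^ l) ^ (2 * t))%N by rewrite /q cardF' -expnM mulnCA mulnA.
have sqQ : sq = ((p ^ l) ^ t)%N.
  by rewrite /sq st -mulnA mulKn // expnM.
have main : (Nsol b k kk m)%:R = qQ ^+ n.-1 - (-1) ^+ n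
    + (k0%:R - 1) * ((qQ - 1) ^+ n - (-1) ^+ n) / qQ - k0%:R * sqE
    - (k0%:R + qQ - 1) * U.
  have NE : #|F|.-1%:R = qQ - 1 :> rat by rewrite -subn1 natrB.
  have epsE r : (2 <= r)%N -> (eps%:~R : rat) ^+ r
      = qQ * ((-1) ^+ (r * t) * (sq ^ (r - 2))%:R).
    by move=> r_ge2; rewrite sqQ -(signed_prime_power_exp qE r_ge2) /eps rmorphXn rmorphN.
  have top : (-1) ^+ n * (eps%:~R ^+ n * (Ifull d)%:R) = qQ * sqE :> rat.
    rewrite epsE // /sqE.
    have -> : (-1) ^+ (t.-1 * n) = (-1) ^+ n * (-1) ^+ (n * t) :> rat.
      (* The sign (-1)^n of the count and (-1)^(nt) from eps^n combine into (-1)^((t-1)n). *)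
      have tE : (n + n * t = 2 * n + t.-1 * n)%N.
        by rewrite -[X in (_ * X)%N](prednK t_gt0) mulnS; ring.
      by rewrite -exprD tE exprD [_ ^+ (2 * n)]exprM sqrrN !expr1n mul1r.
    by ring.
  rewrite -NE; apply: (solve_for_Nsol _ _ NE _ _ EX).
  - by rewrite pnatr_eq0 -lt0n.
  - by rewrite pnatr_eq0 -lt0n.
  - rewrite -exprS prednK // -top.
    move/(congr1 (fun z : int => z%:~R : rat)): zero_count.
    rewrite rmorphM rmorphD !rmorphM !rmorphXn rmorphN1 /= -!pmulrn => ->.
    by rewrite /Ifull; ring.
  move/(congr1 (fun z : int => z%:~R : rat)): star_count.
  rewrite rmorphM rmorphD !rmorphM !rmorphXn rmorphN1 rmorph_sum /= -!pmulrn => ->.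
  under eq_bigr => S _ do rewrite rmorphM rmorphXn /= -pmulrn.
  rewrite sum_Ion_by_card // -top /U -[X in _ + X = _](mulrA).
  have -> : \sum_(2 <= r < n) (eps%:~R : rat) ^+ r *
        \sum_(S : {set 'I_n} | #|S| == r) (Ion d S)%:R
      = qQ * \sum_(2 <= r < n) (-1) ^+ (r * t) * (sq ^ (r - 2))%:R *
          \sum_(S : {set 'I_n} | #|S| == r) (Ion d S)%:R.
    rewrite mulr_sumr !big_nat; apply: eq_bigr => r /andP[r_ge2 _].
    by rewrite epsE // !mulrA.
  by ring.
have first : (Nsol b k kk m)%:R =
    qQ ^+ n.-1 - (-1) ^+ n
    + (k0%:R - 1) * ((qQ - 1) ^+ n - (-1) ^+ n) / qQ
    - (-1) ^+ (t.-1 * n) * k0%:R * (sq ^ (n - 2))%:R * (Ifull d)%:R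
    - (-1) ^+ n * (k0%:R + qQ - 1) *
        \sum_(2 <= r < n) (-1) ^+ (r * t) * (sq ^ (r - 2))%:R *
          \sum_(S : {set 'I_n} | #|S| == r) (Ion d S)%:R.
  by rewrite main /sqE /U; congr (_ - _ - _); ring.
split=> // d_eq; rewrite first.
have D_gt0 : (0 < D)%N := ltnW (ltnW D_gt2).
pose i0 := Ordinal n_gt0.
congr (_ - _ - _).
  by rewrite /Ifull (Ion_const _ i0 D_gt0 d_eq) cardsT card_ord.
congr (_ * _); apply: eq_bigr => r _; congr (_ * _).
rewrite (eq_bigr (fun=> ((D%:R - 1) ^+ r + (-1) ^+ r * (D%:R - 1)) / D%:R)) => [|S /eqP <-].
  rewrite sumr_const -[LHS]mulr_natl; congr (_ * _); congr _%:R.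
  (* With equal moduli all r-subsets contribute alike, and there are binomial(n, r) of them. *)
  have := card_draws 'I_n r; rewrite card_ord => <-.
  by apply: eq_card => S; rewrite inE.
exact: Ion_const.
Qed.
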